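(* Let $\rho>0$ and $\theta\ge0$. The helicoid $\mathcal{S}_\theta$ is stable if $$1<\sqrt{\frac{\pi^2-2\theta^2}{\rho^2}}\,\tanh\sqrt{\frac{\pi^2-2\theta^2}{\rho^2}}$$ (the condition being understood to include $\pi^2-2\theta^2\ge0$, so that the square roots are real).
   Context: $\mathcal{S}_\theta$ is the helicoid of height $\rho$ inside the cylinder $\mathcal{C}=\{x^2+y^2=1,\ 0\le z\le\rho\}$ parameterized by $$(y,z)\mapsto(-y\sin(\theta z/\rho),\,y\cos(\theta z/\rho),\,z),\qquad y\in[-1,1],\ z\in[0,\rho],$$ where $\theta=\theta_0+\pi n$ with $\theta_0\in[0,\pi)$ the angle between the two end wires and $n$ an integer ($\theta\ge 0$). Its boundary consists of the wires $\mathcal{W}$ (the segments $z=0$ and $z=\rho$ of $\mathcal{S}_\theta$) and $\mathcal{Y}=\partial\mathcal{S}_\theta\setminus\mathcal{W}$, two curves ($y=\pm1$) lying on $\mathcal{C}$. It is a critical point of the energy $E(\mathcal{S})=\int_{\mathcal{S}}\sigma\,\mathrm{da}$ ($\sigma>0$ constant) among surfaces spanning $\mathcal{W}$ whose remaining boundary lies on $\mathcal{C}$. Let $\mathbf{z}=(0,0,1)$, let $\mathbf{t}$ be the unit tangent of $\partial\mathcal{S}_\theta$, $K$ the Gaussian curvature of $\mathcal{S}_\theta$, $\nabla_{\mathcal{S}_\theta}$ the surface gradient, and $V_N=\{c\in C^2(\mathcal{S}_\theta,\mathbb{R}):c=0\text{ on }\mathcal{W}\}$. Stability is understood in the sense of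 the strict second-variation criterion: $\mathcal{S}_\theta$ is stable if $$\int_{\mathcal{Y}}(\mathbf{t}\cdot\mathbf{z})^2c^2\,\mathrm{dl}<\int_{\mathcal{S}_\theta}\big(|\nabla_{\mathcal{S}_\theta}c|^2+2Kc^2\big)\,\mathrm{da}\qquad\text{for all nonzero }c\in V_N.$$ *)

(* Defs.v *)
From Stdlib Require Import Reals.
From Coquelicot Require Import Coquelicot.
Open Scope R_scope.

Definition vec : Type := (R * R * R)%type.

Definition mkvec (a b c : R) : vec := (a, b, c).
Definition vx (v : vec) : R := fst (fst v).
Definition vy (v : vec) : R := snd (fst v).
Definition vz (v : vec) : R := snd v.

Definition vadd (v w : vec) : vec := mkvec (vx v + vx w) (vy v + vy w) (vz v + vz w).
Definition vscal (a : R) (v : vec) : vec := mkvec (a * vx v) (a * vy v) (a * vz v).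
Definition vdot (v w : vec) : R := vx v * vx w + vy v * vy w + vz v * vz w.
Definition vcross (v w : vec) : vec :=
  mkvec (vy v * vz w - vz v * vy w)
        (vz v * vx w - vx v * vz w)
        (vx v * vy w - vy v * vx w).
Definition vnorm (v : vec) : R := sqrt (vdot v v).
Definition vunit (v : vec) : vec := vscal (/ vnorm v) v.

Definition ez : vec := mkvec 0 0 1.

(* Differential geometry of a parametrized surface X : (y, z) |-> X y z. *)

Definition dvec (g : R -> vec) (s : R) : vec :=
  mkvec (Derive (fun r => vx (g r)) s)
        (Derive (fun r => vy (g r)) s)
        (Derive (fun r => vz (g r)) s).

Definition X_y (X : R -> R -> vec) (y z : R) : vec := dvec (fun s => X s z) y.
Definition X_z (X : R -> R -> vec) (y z : R) : vec := dvec (fun s => X y s) z.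

Definition fffE (X : R -> R -> vec) (y z : R) : R := vdot (X_y X y z) (X_y X y z).
Definition fffF (X : R -> R -> vec) (y z : R) : R := vdot (X_y X y z) (X_z X y z).
Definition fffG (X : R -> R -> vec) (y z : R) : R := vdot (X_z X y z) (X_z X y z).
Definition fff_det (X : R -> R -> vec) (y z : R) : R :=
  fffE X y z * fffG X y z - (fffF X y z) ^ 2.

Definition unit_normal (X : R -> R -> vec) (y z : R) : vec :=
  vunit (vcross (X_y X y z) (X_z X y z)).

Definition sffL (X : R -> R -> vec) (y z : R) : R :=
  vdot (X_y (X_y X) y z) (unit_normal X y z).
Definition sffM (X : R -> R -> vec) (y z : R) : R :=
  vdot (X_y (X_z X) y z) (unit_normal X y z).
Definition sffN (X : R -> R -> vec) (y z : R) : R :=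
  vdot (X_z (X_z X) y z) (unit_normal X y z).

Definition gauss_curvature (X : R -> R -> vec) (y z : R) : R :=
  (sffL X y z * sffN X y z - (sffM X y z) ^ 2) / fff_det X y z.

Definition area_element (X : R -> R -> vec) (y z : R) : R :=
  vnorm (vcross (X_y X y z) (X_z X y z)).

(* The tangent vector g^{ij} (d_i (c o X)) d_j X, with g^{ij} the inverse of
   the first fundamental form. *)
Definition surface_gradient (X : R -> R -> vec) (c : vec -> R) (y z : R) : vec :=
  let cy := Derive (fun s => c (X s z)) y in
  let cz := Derive (fun s => c (X y s)) z in
  vadd
    (vscal ((fffG X y z * cy - fffF X y z * cz) / fff_det X y z) (X_y X y z))
    (vscal ((fffE X y z * cz - fffF X y z * cy) / fff_det X y z) (X_z X y z)).

(* Integral over X ([a, b] x [p, q]) of the function whose value at X y z is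
   f y z, for X injective.  The values of f on the edges of the rectangle do
   not affect it. *)
Definition surface_integral (X : R -> R -> vec) (a b p q : R)
    (f : R -> R -> R) : R :=
  RInt (fun z => RInt (fun y => f y z * area_element X y z) a b) p q.

Definition unit_tangent (g : R -> vec) (s : R) : vec := vunit (dvec g s).

Definition curve_integral (g : R -> vec) (p q : R) (f : R -> R) : R :=
  RInt (fun s => f s * vnorm (dvec g s)) p q.

Definition helicoid (rho theta y z : R) : vec :=
  mkvec (- y * sin (theta * z / rho)) (y * cos (theta * z / rho)) z.

Definition in_rect (rho y z : R) : Prop := -1 <= y <= 1 /\ 0 <= z <= rho.

Definition on_helicoid (rho theta : R) (p : vec) : Prop :=
  exists y z, in_rect rho y z /\ p = helicoid rho theta y z.

Definition on_wires (rho theta : R) (p : vec) : Prop :=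
  exists y z, in_rect rho y z /\ (z = 0 \/ z = rho) /\ p = helicoid rho theta y z.

(* The integral over the free boundary, i.e. the two curves y = 1 and y = -1;
   F g s is the integrand at the point g s of the boundary curve g. *)
Definition free_boundary_integral (rho theta : R)
    (F : (R -> vec) -> R -> R) : R :=
  curve_integral (helicoid rho theta 1) 0 rho (F (helicoid rho theta 1)) +
  curve_integral (helicoid rho theta (-1)) 0 rho (F (helicoid rho theta (-1))).

(* c is C^2 up to the boundary: in the chart given by the parametrization, it
   extends to a C^2 function on a neighbourhood of the closed rectangle.  Only
   the values of c on the helicoid are constrained. *)
Definition C2_on_helicoid (rho theta : R) (c : vec -> R) : Prop :=
  exists u : R -> R -> R,
    (forall y z, in_rect rho y z ->
       locally_2d (fun s t => ex_diff_n u 2 s t) y z) /\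
    (forall y z, in_rect rho y z -> c (helicoid rho theta y z) = u y z).

Definition V_N (rho theta : R) (c : vec -> R) : Prop :=
  C2_on_helicoid rho theta c /\
  (forall p, on_wires rho theta p -> c p = 0).

Definition nonzero_on_helicoid (rho theta : R) (c : vec -> R) : Prop :=
  exists p, on_helicoid rho theta p /\ c p <> 0.

Definition stable (rho theta : R) : Prop :=
  forall c : vec -> R,
    V_N rho theta c ->
    nonzero_on_helicoid rho theta c ->
    free_boundary_integral rho theta
      (fun g s => (vdot (unit_tangent g s) ez) ^ 2 * (c (g s)) ^ 2)
    < surface_integral (helicoid rho theta) (-1) 1 0 rho
        (fun y z =>
           vdot (surface_gradient (helicoid rho theta) c y z)
                (surface_gradient (helicoid rho theta) c y z)
           + 2 * gauss_curvature (helicoid rho theta) y z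
               * (c (helicoid rho theta y z)) ^ 2).

(* Main.v *)
Require Import Defs.
From Stdlib Require Import Reals Lra ClassicalEpsilon.
From Coquelicot Require Import Coquelicot.
Open Scope R_scope.

(** Write w = theta / rho and A(y) = sqrt(1 + w^2 y^2).  In the chart (y, z) the
    area element is A, the gradient squared is c_y^2 + c_z^2 / A^2, the curvature
    is - w^2 / A^4, and the boundary weight times the length element is 1 / A(1).
    So the claim is
      int (c(1,z)^2 + c(-1,z)^2) / A(1) dz
        < iint (A c_y^2 + c_z^2 / A - 2 w^2 c^2 / A^3) dy dz
    for every nonzero c vanishing at z = 0 and z = rho.

    Let k^2 = (pi / rho)^2 - 2 w^2, so that the hypothesis reads 1 < k tanh k.
    In the direction z, Wirtinger's inequality bounds the integral of c_z^2
    below by (pi / rho)^2 times that of c^2; since A >= 1, what remains is at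
    least A c_y^2 + k^2 c^2 / A.  In the direction y, the one-dimensional
    problem of bounding the boundary values c(1)^2 + c(-1)^2 by this energy has,
    for w = 0, the extremal cosh(k y), whence the threshold k tanh k = 1.

    Both bounds are obtained pointwise, by adding exact derivatives and
    completing squares (Legendre's method, with solutions of a Riccati
    inequality as multipliers):
    - subtracting d/dy (W c^2), with W(y) = tanh(k y) / (tanh(k) A(y)), whose
      flux through y = 1 and y = -1 is exactly the left-hand side;
    - subtracting (1 / A) d/dz (V c^2), with V(z) = - b tan(b (z - rho / 2)),
      which integrates to zero because c vanishes on the wires.
    The frequency b is taken slightly below pi / rho, which keeps V finite on
    [0, rho].  Since 1 < k tanh k is strict, there is room for this and still
    for a positive multiple d of c^2 / A, whose integral makes the inequality
    strict.  The pointwise inequality is [integrand_bound], the two integrations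
    are [RInt_flux_y] and [iterated_RInt_flux_z], and [second_variation_pos]
    combines them. *)

(** * Continuity and positivity of integrals depending on a variable *)

(** Tube lemma.  The indicator function of [P] is locally constant along the
    compact segment, hence uniformly continuous near it; a variation smaller
    than 1 of a function with values 0 and 1 is zero. *)
Lemma locally_2d_tube (P : R -> R -> Prop) (a b z : R) :
  (forall y, a <= y <= b -> locally_2d P y z) ->
  locally z (fun s => forall y, a <= y <= b -> P y s).
Proof.
  intros HP.
  set (ind := fun y s => if excluded_middle_informative (P y s) then 1 else 0).
  assert (Hind : forall y, a <= y <= b -> continuity_2d_pt ind y z).
  { intros y Hy.
    apply continuity_2d_pt_ext_loc with (f := fun _ _ => 1).
    - destruct (HP y Hy) as [d Hd]. exists d. intros s t Hs Ht.
      unfold ind. destruct excluded_middle_informative as [|n]; auto.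
      now elim n; apply Hd.
    - apply continuity_2d_pt_const. }
  destruct (uniform_continuity_2d_1d ind a b z Hind (mkposreal 1 Rlt_0_1))
    as [d Hd].
  exists d. intros s Hs y Hy.
  change (Rabs (s - z) < d) in Hs.
  assert (Hz : P y z).
  { apply (locally_2d_singleton P). now apply HP. }
  destruct (Rabs_def2 _ _ Hs).
  assert (H1 := Hd y z y s Hy). simpl in H1.
  destruct d as [d Hd0]; simpl in *.
  assert (H2 : Rabs (ind y s - ind y z) < 1).
  { apply H1; try lra. rewrite Rminus_diag, Rabs_R0; lra. }
  unfold ind in H2.
  destruct (excluded_middle_informative (P y s)) as [|n]; auto.
  destruct (excluded_middle_informative (P y z)) as [|n']; [|tauto].
  exfalso. rewrite Rabs_left in H2; lra.
Qed.

Lemma continuity_2d_pt_swap (f : R -> R -> R) (y z : R) :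
  continuity_2d_pt f y z -> continuity_2d_pt (fun s t => f t s) z y.
Proof.
  intros H eps. destruct (H eps) as [d Hd]. exists d. auto.
Qed.

Lemma continuity_2d_pt_sqr (f : R -> R -> R) (y z : R) :
  continuity_2d_pt f y z -> continuity_2d_pt (fun s t => f s t ^ 2) y z.
Proof.
  intros H.
  apply continuity_2d_pt_ext with (f := fun s t => f s t * f s t).
  - intros; ring.
  - now apply continuity_2d_pt_mult.
Qed.

Lemma continuity_2d_pt_fst (g : R -> R) (y z : R) :
  continuous g y -> continuity_2d_pt (fun s _ => g s) y z.
Proof.
  intros H.
  apply (continuity_1d_2d_pt_comp g (fun s _ => s)).
  - now apply continuity_pt_filterlim.
  - apply continuity_2d_pt_id1.
Qed.

Lemma continuity_2d_pt_snd (g : R -> R) (y z : R) :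
  continuous g z -> continuity_2d_pt (fun _ t => g t) y z.
Proof.
  intros H.
  apply (continuity_1d_2d_pt_comp g (fun _ t => t)).
  - now apply continuity_pt_filterlim.
  - apply continuity_2d_pt_id2.
Qed.

Lemma continuity_2d_pt_slice_l (f : R -> R -> R) (y z : R) :
  continuity_2d_pt f y z -> continuous (fun s => f s z) y.
Proof.
  intros H. apply continuity_pt_filterlim, continuity_pt_locally.
  intros eps. destruct (H eps) as [d Hd]. exists d. intros s Hs.
  apply Hd; auto. rewrite Rminus_diag, Rabs_R0. apply cond_pos.
Qed.

Lemma continuity_2d_pt_slice_r (f : R -> R -> R) (y z : R) :
  continuity_2d_pt f y z -> continuous (fun t => f y t) z.
Proof.
  intros H. apply (continuity_2d_pt_slice_l (fun s t => f t s)).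
  now apply continuity_2d_pt_swap.
Qed.

Lemma ex_RInt_slice (f : R -> R -> R) (a b z : R) (Hab : a <= b) :
  (forall y, a <= y <= b -> continuity_2d_pt f y z) ->
  ex_RInt (fun y => f y z) a b.
Proof.
  intros H. apply (ex_RInt_continuous (V := R_CompleteNormedModule)).
  rewrite Rmin_left, Rmax_right by easy.
  intros y Hy. now apply continuity_2d_pt_slice_l, H.
Qed.

(** By compactness of [a, b] the integrand varies by less than
    eps / (b - a + 1) when the variable moves; the added 1 covers a = b. *)
Lemma continuous_RInt_param (f : R -> R -> R) (a b z : R) (Hab : a <= b) :
  (forall y, a <= y <= b -> continuity_2d_pt f y z) ->
  locally z (fun t => ex_RInt (fun y => f y t) a b) ->
  continuous (fun t => RInt (fun y => f y t) a b) z.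
Proof.
  intros Hf Hex.
  apply continuity_pt_filterlim, continuity_pt_locally. intros eps.
  assert (Hpos : 0 < eps / (b - a + 1)).
  { apply Rdiv_lt_0_compat; [apply cond_pos | lra]. }
  destruct (uniform_continuity_2d_1d f a b z Hf (mkposreal _ Hpos)) as [d Hd].
  assert (Hz := locally_singleton _ _ Hex).
  generalize (filter_and _ _ Hex (locally_ball z d)).
  apply filter_imp. intros t [Ht Hball].
  change (Rabs (t - z) < d) in Hball.
  destruct (Rabs_def2 _ _ Hball).
  change (Rabs (minus (RInt (fun y => f y t) a b) (RInt (fun y => f y z) a b)) < eps).
  rewrite <- (RInt_minus (V := R_CompleteNormedModule)) by auto.
  apply Rle_lt_trans with (eps / (b - a + 1) * (b - a)).
  - rewrite Rmult_comm.
    apply (norm_RInt_le_const (V := R_NormedModule)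
             (fun y => minus (f y t) (f y z)) a b); auto.
    + intros y Hy. apply Rlt_le, (Hd y z y t); auto; destruct d; simpl in *; try lra.
      rewrite Rminus_diag, Rabs_R0; lra.
    + apply (RInt_correct (V := R_CompleteNormedModule)).
      now apply (ex_RInt_minus (V := R_NormedModule)).
  - destruct eps as [e He]; simpl in *.
    apply Rlt_le_trans with (e / (b - a + 1) * (b - a + 1)).
    + apply Rmult_lt_compat_l; lra.
    + right; field; lra.
Qed.

Lemma RInt_pos_of_pos_at (f : R -> R) (a b x : R) :
  a < b -> a <= x <= b ->
  (forall t, a <= t <= b -> continuous f t) ->
  (forall t, a <= t <= b -> 0 <= f t) ->
  0 < f x ->
  0 < RInt f a b.
Proof.
  intros Hab Hx Hc Hf Hfx.
  destruct (proj1 (continuity_pt_locally f x)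
              (proj2 (continuity_pt_filterlim f x) (Hc x Hx))
              (mkposreal _ Hfx)) as [d Hd].
  assert (Hd0 := cond_pos d).
  set (l := Rmax a (x - d / 2)). set (r := Rmin b (x + d / 2)).
  assert (Hl : a <= l /\ x - d / 2 <= l /\ l <= x)
    by (unfold l; repeat split; [apply Rmax_l | apply Rmax_r | apply Rmax_lub; lra]).
  assert (Hr : r <= b /\ r <= x + d / 2 /\ x <= r)
    by (unfold r; repeat split; [apply Rmin_l | apply Rmin_r | apply Rmin_glb; lra]).
  assert (Hlr : l < r).
  { unfold l, r. apply Rmax_lub_lt; apply Rmin_glb_lt; lra. }
  assert (Hex : forall s t, a <= s -> s <= t -> t <= b -> ex_RInt f s t).
  { intros s t Hs Hst Ht. apply (ex_RInt_continuous (V := R_CompleteNormedModule)).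
    rewrite Rmin_left, Rmax_right by easy. intros; apply Hc; lra. }
  assert (Hmid : 0 < RInt f l r).
  { apply RInt_gt_0; auto.
    - intros t Ht. assert (H := Hd t).
      simpl in H. change (ball x d t) with (Rabs (t - x) < d) in H.
      assert (H' : Rabs (f t - f x) < f x) by (apply H, Rabs_def1; lra).
      apply Rabs_def2 in H'. lra.
    - intros; apply Hc; lra. }
  rewrite <- (RInt_Chasles f a l b) by (apply Hex; lra).
  rewrite <- (RInt_Chasles f l r b) by (apply Hex; lra).
  assert (0 <= RInt f a l) by (apply RInt_ge_0; [lra | apply Hex; lra | intros; apply Hf; lra]).
  assert (0 <= RInt f r b) by (apply RInt_ge_0; [lra | apply Hex; lra | intros; apply Hf; lra]).
  unfold plus; simpl. lra.
Qed.

(** * Integrals over a rectangle and fluxes *)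

Definition C1_pt (u : R -> R -> R) (y z : R) : Prop :=
  continuity_2d_pt u y z /\
  ex_derive (fun s => u s z) y /\
  ex_derive (fun t => u y t) z /\
  continuity_2d_pt (fun s t => Derive (fun r => u r t) s) y z /\
  continuity_2d_pt (fun s t => Derive (fun r => u s r) t) y z.

(** Holding on whole slices [a, b] x {t}, for t in a neighbourhood of [p, q]:
    differentiation under the integral sign at z = p and z = q needs the
    integrand on both sides of these values. *)
Definition near_slices (P : R -> R -> Prop) (a b p q : R) : Prop :=
  forall z, p <= z <= q -> locally z (fun t => forall y, a <= y <= b -> P y t).

Definition iterated_RInt (f : R -> R -> R) (a b p q : R) : R :=
  RInt (fun z => RInt (fun y => f y z) a b) p q.

Lemma near_slices_imp (P Q : R -> R -> Prop) (a b p q : R) :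
  (forall y z, a <= y <= b -> P y z -> Q y z) ->
  near_slices P a b p q -> near_slices Q a b p q.
Proof.
  intros HPQ HP z Hz. generalize (HP z Hz). apply filter_imp. auto.
Qed.

Lemma near_slices_at (P : R -> R -> Prop) (a b p q y z : R) :
  near_slices P a b p q -> a <= y <= b -> p <= z <= q -> P y z.
Proof.
  intros HP Hy Hz. exact (locally_singleton _ _ (HP z Hz) y Hy).
Qed.

Lemma continuous_inner_RInt (f : R -> R -> R) (a b p q z : R) (Hab : a <= b) :
  near_slices (continuity_2d_pt f) a b p q -> p <= z <= q ->
  continuous (fun t => RInt (fun y => f y t) a b) z.
Proof.
  intros Hf Hz. apply continuous_RInt_param; auto.
  - intros y Hy. now apply (near_slices_at _ a b p q).
  - generalize (Hf z Hz). apply filter_imp.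
    intros t Ht. now apply ex_RInt_slice.
Qed.

Lemma ex_RInt_inner (f : R -> R -> R) (a b p q z : R) (Hab : a <= b) :
  near_slices (continuity_2d_pt f) a b p q -> p <= z <= q ->
  ex_RInt (fun y => f y z) a b.
Proof.
  intros Hf Hz. apply ex_RInt_slice; auto.
  intros y Hy. now apply (near_slices_at _ a b p q).
Qed.

Lemma ex_RInt_outer (f : R -> R -> R) (a b p q : R) (Hab : a <= b) (Hpq : p <= q) :
  near_slices (continuity_2d_pt f) a b p q ->
  ex_RInt (fun z => RInt (fun y => f y z) a b) p q.
Proof.
  intros Hf. apply (ex_RInt_continuous (V := R_CompleteNormedModule)).
  rewrite Rmin_left, Rmax_right by easy.
  intros z Hz. now apply (continuous_inner_RInt f a b p q).
Qed.

Lemma iterated_RInt_plus (f g : R -> R -> R) (a b p q : R)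
    (Hab : a <= b) (Hpq : p <= q) :
  near_slices (continuity_2d_pt f) a b p q ->
  near_slices (continuity_2d_pt g) a b p q ->
  iterated_RInt (fun y z => f y z + g y z) a b p q
  = iterated_RInt f a b p q + iterated_RInt g a b p q.
Proof.
  intros Hf Hg. unfold iterated_RInt.
  rewrite <- (RInt_plus (V := R_CompleteNormedModule)) by now apply ex_RInt_outer.
  apply RInt_ext. rewrite Rmin_left, Rmax_right by easy. intros z Hz.
  assert (Hz' : p <= z <= q) by lra.
  apply (RInt_plus (V := R_CompleteNormedModule));
    now apply (ex_RInt_inner _ a b p q).
Qed.

Lemma iterated_RInt_le (f g : R -> R -> R) (a b p q : R)
    (Hab : a <= b) (Hpq : p <= q) :
  near_slices (continuity_2d_pt f) a b p q ->
  near_slices (continuity_2d_pt g) a b p q ->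
  (forall y z, a <= y <= b -> p <= z <= q -> f y z <= g y z) ->
  iterated_RInt f a b p q <= iterated_RInt g a b p q.
Proof.
  intros Hf Hg Hfg. apply RInt_le; auto using ex_RInt_outer.
  intros z Hz. assert (Hz' : p <= z <= q) by lra.
  apply RInt_le; auto.
  - now apply (ex_RInt_inner _ a b p q).
  - now apply (ex_RInt_inner _ a b p q).
  - intros y Hy. apply Hfg; lra.
Qed.

Lemma iterated_RInt_pos (f : R -> R -> R) (a b p q y0 z0 : R)
    (Hab : a < b) (Hpq : p < q) :
  near_slices (continuity_2d_pt f) a b p q ->
  (forall y z, a <= y <= b -> p <= z <= q -> 0 <= f y z) ->
  a <= y0 <= b -> p <= z0 <= q -> 0 < f y0 z0 ->
  0 < iterated_RInt f a b p q.
Proof.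
  intros Hf Hpos Hy0 Hz0 H0.
  apply RInt_pos_of_pos_at with (x := z0); auto.
  - intros z Hz. apply (continuous_inner_RInt f a b p q); auto; lra.
  - intros z Hz. apply RInt_ge_0; [lra | | intros; apply Hpos; lra].
    apply (ex_RInt_inner _ a b p q); auto; lra.
  - apply RInt_pos_of_pos_at with (x := y0); auto.
    intros y Hy. apply continuity_2d_pt_slice_l. now apply (near_slices_at _ a b p q).
Qed.

Ltac continuity_2d :=
  repeat first
    [ assumption
    | apply continuity_2d_pt_fst; assumption
    | apply continuity_2d_pt_snd; assumption
    | apply continuity_2d_pt_const
    | apply continuity_2d_pt_plus
    | apply continuity_2d_pt_minus
    | apply continuity_2d_pt_sqr
    | apply continuity_2d_pt_mult ].

Lemma is_derive_continuous (f : R -> R) (x l : R) :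
  is_derive f x l -> continuous f x.
Proof.
  intros H. apply (ex_derive_continuous (K := R_AbsRing) (V := R_NormedModule)).
  now exists l.
Qed.

(** The integrand is the derivative of w u^2 along y. *)
Lemma RInt_flux_y (w w' : R -> R) (u : R -> R -> R) (a b z : R) (Hab : a <= b) :
  (forall y, a <= y <= b -> is_derive w y (w' y) /\ continuous w' y) ->
  (forall y, a <= y <= b -> C1_pt u y z) ->
  RInt (fun y => w' y * u y z ^ 2
                 + 2 * w y * u y z * Derive (fun s => u s z) y) a b
  = w b * u b z ^ 2 - w a * u a z ^ 2.
Proof.
  intros Hw Hu.
  apply is_RInt_unique.
  apply (is_RInt_derive (fun y => w y * u y z ^ 2));
    rewrite Rmin_left, Rmax_right by easy; intros y Hy;
    destruct (Hw y Hy) as [Hd Hc]; destruct (Hu y Hy) as (Cu & Dy & _ & Cy & _).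
  - apply Derive_correct in Dy. auto_derive.
    + repeat split; auto. now exists (w' y). now exists (Derive (fun s => u s z) y).
    + replace (Derive (fun s : R => w s) y) with (w' y)
        by (symmetry; exact (is_derive_unique w y (w' y) Hd)).
      ring.
  - assert (continuous w y) by now apply is_derive_continuous with (w' y).
    apply (continuity_2d_pt_slice_l (fun y z => w' y * u y z ^ 2
                 + 2 * w y * u y z * Derive (fun s => u s z) y)).
    continuity_2d.
Qed.

(** The inner integral is the derivative in z of int m v u^2 dy, which vanishes
    at both ends.  Differentiating under the integral sign replaces an exchange
    of the order of integration. *)
Lemma iterated_RInt_flux_z (m v v' : R -> R) (u : R -> R -> R) (a b p q : R)
    (Hab : a <= b) (Hpq : p <= q) :
  (forall y, a <= y <= b -> continuous m y) ->
  (forall z, p <= z <= q ->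
     locally z (fun t => is_derive v t (v' t) /\ continuous v' t)) ->
  (forall y z, a <= y <= b -> p <= z <= q -> locally_2d (C1_pt u) y z) ->
  (forall y, a <= y <= b -> u y p = 0 /\ u y q = 0) ->
  iterated_RInt (fun y z => m y * (v' z * u y z ^ 2
                 + 2 * v z * u y z * Derive (fun t => u y t) z)) a b p q
  = 0.
Proof.
  intros Hm Hv Hu2 H0.
  assert (Hu : near_slices (C1_pt u) a b p q)
    by (intros z Hz; apply locally_2d_tube; auto).
  set (g := fun z y => m y * (v z * u y z ^ 2)).
  set (f := fun y z => m y * (v' z * u y z ^ 2
                 + 2 * v z * u y z * Derive (fun t => u y t) z)).
  assert (Huv : near_slices (fun y z =>
            C1_pt u y z /\ (is_derive v z (v' z) /\ continuous v' z)) a b p q).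
  { intros z Hz. generalize (filter_and _ _ (Hu z Hz) (Hv z Hz)).
    apply filter_imp. intros t [H1 H2]. auto. }
  assert (Hg : forall y z,
    C1_pt u y z /\ (is_derive v z (v' z) /\ continuous v' z) ->
    is_derive (fun t => g t y) z (f y z)).
  { intros y z [(_ & _ & Dz & _ & _) [Hd _]].
    unfold g, f. apply Derive_correct in Dz. auto_derive.
    - repeat split; auto. now exists (v' z). now exists (Derive (fun t => u y t) z).
    - replace (Derive (fun t : R => v t) z) with (v' z)
        by (symmetry; exact (is_derive_unique v z (v' z) Hd)).
      ring. }
  assert (Hvc : forall z, is_derive v z (v' z) -> continuous v z)
    by (intros z; apply is_derive_continuous).
  assert (Hf : near_slices (continuity_2d_pt f) a b p q).
  { revert Huv. apply near_slices_imp.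
    intros y z Hy [(Cu & _ & _ & _ & Cz) [Hd Hc]].
    assert (continuous m y) by auto. assert (continuous v z) by auto.
    unfold f. continuity_2d. }
  assert (Hgc : near_slices (continuity_2d_pt (fun y z => g z y)) a b p q).
  { revert Huv. apply near_slices_imp.
    intros y z Hy [(Cu & _ & _ & _ & Cz) [Hd Hc]].
    assert (continuous m y) by auto. assert (continuous v z) by auto.
    unfold g. continuity_2d. }
  assert (HD : forall z, p <= z <= q ->
    is_derive (fun t => RInt (fun y => g t y) a b) z (RInt (fun y => f y z) a b)).
  { intros z Hz.
    replace (RInt (fun y => f y z) a b)
      with (RInt (fun y => Derive (fun t => g t y) z) a b).
    - apply (is_derive_RInt_param g a b z);
        try (rewrite Rmin_left, Rmax_right by easy).
      + generalize (Huv z Hz). apply filter_imp. intros t Ht y Hy.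
        exists (f y t). now apply Hg, Ht.
      + intros y Hy. apply continuity_2d_pt_swap.
        apply continuity_2d_pt_ext_loc with (f := f).
        * assert (Hvz : locally_2d (fun _ t => is_derive v t (v' t) /\ continuous v' t) y z).
          { destruct (Hv z Hz) as [d Hd]. exists d. intros s t _ Ht. now apply Hd. }
          generalize (locally_2d_and _ _ _ _ (Hu2 y z Hy Hz) Hvz).
          apply locally_2d_impl, locally_2d_forall. intros s t Hst.
          symmetry. now apply is_derive_unique, Hg.
        * now apply (near_slices_at _ a b p q).
      + generalize (Hgc z Hz). apply filter_imp. intros t Ht.
        now apply (ex_RInt_slice (fun y z => g z y)).
    - apply RInt_ext. rewrite Rmin_left, Rmax_right by easy.
      intros y Hy. apply is_derive_unique, Hg.
      apply (near_slices_at _ _ _ _ _ y z Huv); lra. }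
  unfold iterated_RInt.
  rewrite (is_RInt_unique _ _ _ _
    (is_RInt_derive (fun t => RInt (fun y => g t y) a b)
       (fun z => RInt (fun y => f y z) a b) p q
       ltac:(rewrite Rmin_left, Rmax_right by easy; exact HD)
       ltac:(rewrite Rmin_left, Rmax_right by easy; intros z Hz;
             now apply (continuous_inner_RInt f a b p q)))).
  unfold minus, plus, opp; simpl.
  assert (Hend : forall z, z = p \/ z = q -> RInt (fun y => g z y) a b = 0).
  { intros z Hz. rewrite (RInt_ext _ (fun _ => 0)).
    - rewrite RInt_const. unfold scal; simpl; unfold mult; simpl. ring.
    - rewrite Rmin_left, Rmax_right by easy. intros y Hy.
      destruct (H0 y) as [Hp Hq]; [lra|].
      unfold g. destruct Hz as [-> | ->]; [rewrite Hp | rewrite Hq]; lra. }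
  rewrite !Hend by auto. lra.
Qed.

(** * Geometry of the helicoid *)

(** The length of the z-coordinate vector of the chart, which is also the area
    element since the other coordinate vector is a unit vector orthogonal to
    it. *)
Definition stretch (rho theta y : R) : R := sqrt (1 + (theta / rho * y) ^ 2).

Lemma stretch_sqr (rho theta y : R) :
  stretch rho theta y ^ 2 = 1 + (theta / rho * y) ^ 2.
Proof.
  apply pow2_sqrt. assert (H := pow2_ge_0 (theta / rho * y)). lra.
Qed.

Lemma stretch_ge_1 (rho theta y : R) : 1 <= stretch rho theta y.
Proof.
  rewrite <- sqrt_1 at 1. apply sqrt_le_1_alt.
  assert (H := pow2_ge_0 (theta / rho * y)). lra.
Qed.

Lemma stretch_opp (rho theta y : R) : stretch rho theta (- y) = stretch rho theta y.
Proof. unfold stretch. f_equal. ring. Qed.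

Lemma helicoid_y (rho theta y z : R) :
  X_y (helicoid rho theta) y z
  = mkvec (- sin (theta * z / rho)) (cos (theta * z / rho)) 0.
Proof.
  unfold X_y, dvec, helicoid, mkvec, vx, vy, vz; simpl.
  f_equal; [f_equal|]; apply is_derive_unique; auto_derive; auto; ring.
Qed.

Lemma helicoid_z (rho theta y z : R) :
  X_z (helicoid rho theta) y z
  = mkvec (- y * (theta / rho) * cos (theta * z / rho))
          (- y * (theta / rho) * sin (theta * z / rho)) 1.
Proof.
  unfold X_z, dvec, helicoid, mkvec, vx, vy, vz; simpl.
  f_equal; [f_equal|]; apply is_derive_unique; auto_derive; auto; unfold Rdiv; ring.
Qed.

Lemma dvec_ext (g h : R -> vec) (s : R) :
  (forall r, g r = h r) -> dvec g s = dvec h s.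
Proof.
  intros H. unfold dvec. f_equal; apply Derive_ext; intros; now rewrite H.
Qed.

Lemma helicoid_yy (rho theta y z : R) :
  X_y (X_y (helicoid rho theta)) y z = mkvec 0 0 0.
Proof.
  unfold X_y at 1. rewrite (dvec_ext _ _ _ (fun r => helicoid_y rho theta r z)).
  unfold dvec, mkvec, vx, vy, vz; simpl. now rewrite !Derive_const.
Qed.

Lemma helicoid_zy (rho theta y z : R) :
  X_y (X_z (helicoid rho theta)) y z
  = mkvec (- (theta / rho) * cos (theta * z / rho))
          (- (theta / rho) * sin (theta * z / rho)) 0.
Proof.
  unfold X_y at 1. rewrite (dvec_ext _ _ _ (fun r => helicoid_z rho theta r z)).
  unfold dvec, mkvec, vx, vy, vz; simpl.
  f_equal; [f_equal|]; apply is_derive_unique; auto_derive; auto; ring.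
Qed.

Lemma helicoid_zz (rho theta y z : R) :
  X_z (X_z (helicoid rho theta)) y z
  = mkvec (y * (theta / rho) ^ 2 * sin (theta * z / rho))
          (- y * (theta / rho) ^ 2 * cos (theta * z / rho)) 0.
Proof.
  unfold X_z at 1. rewrite (dvec_ext _ _ _ (fun r => helicoid_z rho theta y r)).
  unfold dvec, mkvec, vx, vy, vz; simpl.
  f_equal; [f_equal|]; apply is_derive_unique; auto_derive; auto; unfold Rdiv; ring.
Qed.

Ltac unfold_vec := unfold vdot, vcross, vscal, vadd, mkvec, vx, vy, vz; simpl fst; simpl snd.

Lemma sin_cos_sqr (x : R) : sin x ^ 2 = 1 - cos x ^ 2.
Proof. assert (H := sin2_cos2 x). unfold Rsqr in H. lra. Qed.

Lemma helicoid_E (rho theta y z : R) : fffE (helicoid rho theta) y z = 1.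
Proof.
  unfold fffE. rewrite helicoid_y. unfold_vec.
  ring_simplify. rewrite sin_cos_sqr. ring.
Qed.

Lemma helicoid_F (rho theta y z : R) : fffF (helicoid rho theta) y z = 0.
Proof. unfold fffF. rewrite helicoid_y, helicoid_z. unfold_vec. ring. Qed.

Lemma helicoid_G (rho theta y z : R) :
  fffG (helicoid rho theta) y z = stretch rho theta y ^ 2.
Proof.
  unfold fffG. rewrite helicoid_z, stretch_sqr. unfold_vec.
  generalize (theta / rho), (sin_cos_sqr (theta * z / rho)). intros w H.
  ring_simplify. rewrite H. ring.
Qed.

Lemma helicoid_cross (rho theta y z : R) :
  vcross (X_y (helicoid rho theta) y z) (X_z (helicoid rho theta) y z)
  = mkvec (cos (theta * z / rho)) (sin (theta * z / rho)) (theta / rho * y).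
Proof.
  rewrite helicoid_y, helicoid_z. unfold_vec.
  generalize (theta / rho), (sin_cos_sqr (theta * z / rho)). intros w H.
  f_equal; [f_equal; ring|]. ring_simplify. rewrite H. ring.
Qed.

Lemma helicoid_area (rho theta y z : R) :
  area_element (helicoid rho theta) y z = stretch rho theta y.
Proof.
  unfold area_element. rewrite helicoid_cross. unfold vnorm, stretch. f_equal.
  unfold_vec.
  generalize (theta / rho), (sin_cos_sqr (theta * z / rho)). intros w H.
  ring_simplify. rewrite H. ring.
Qed.

Lemma helicoid_curvature (rho theta y z : R) :
  gauss_curvature (helicoid rho theta) y z
  = - (theta / rho) ^ 2 / stretch rho theta y ^ 4.
Proof.
  unfold gauss_curvature, fff_det, sffL, sffM, sffN, unit_normal, vunit.
  fold (area_element (helicoid rho theta) y z).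
  rewrite helicoid_E, helicoid_F, helicoid_G, helicoid_area.
  rewrite helicoid_cross, helicoid_yy, helicoid_zy, helicoid_zz. unfold_vec.
  assert (HA := stretch_ge_1 rho theta y).
  generalize (sin_cos_sqr (theta * z / rho)).
  generalize dependent (stretch rho theta y). intros A HA.
  generalize (theta / rho), (theta * z / rho). intros w t H.
  replace (- w * cos t * (/ A * cos t) + - w * sin t * (/ A * sin t)
           + 0 * (/ A * (w * y)))
    with (- w / A * (cos t ^ 2 + sin t ^ 2)) by (field; lra).
  rewrite H. field. lra.
Qed.

Lemma helicoid_gradient_sqr (rho theta y z : R) (c : vec -> R) :
  vdot (surface_gradient (helicoid rho theta) c y z)
       (surface_gradient (helicoid rho theta) c y z)
  = Derive (fun s => c (helicoid rho theta s z)) y ^ 2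
    + Derive (fun t => c (helicoid rho theta y t)) z ^ 2 / stretch rho theta y ^ 2.
Proof.
  unfold surface_gradient, fff_det.
  set (X := helicoid rho theta).
  set (cy := Derive (fun s => c (X s z)) y).
  set (cz := Derive (fun t => c (X y t)) z).
  assert (HE := helicoid_E rho theta y z).
  assert (HF := helicoid_F rho theta y z).
  assert (HG := helicoid_G rho theta y z).
  fold X in HE, HF, HG. rewrite HE, HF, HG.
  unfold fffE in HE. unfold fffF in HF. unfold fffG in HG.
  assert (HA := stretch_ge_1 rho theta y).
  generalize dependent (stretch rho theta y). intros A HG HA.
  transitivity (cy ^ 2 * vdot (X_y X y z) (X_y X y z)
    + 2 * (cy * cz / A ^ 2) * vdot (X_y X y z) (X_z X y z)
    + (cz / A ^ 2) ^ 2 * vdot (X_z X y z) (X_z X y z)).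
  - unfold_vec. field. lra.
  - rewrite HE, HF, HG. field. lra.
Qed.

Lemma helicoid_boundary_speed (rho theta y s : R) :
  vnorm (dvec (helicoid rho theta y) s) = stretch rho theta y.
Proof.
  change (dvec (helicoid rho theta y) s) with (X_z (helicoid rho theta) y s).
  unfold vnorm. fold (fffG (helicoid rho theta) y s).
  rewrite helicoid_G. apply sqrt_pow2.
  assert (H := stretch_ge_1 rho theta y). lra.
Qed.

Lemma helicoid_boundary_weight (rho theta y s : R) :
  vdot (unit_tangent (helicoid rho theta y) s) ez ^ 2 = / stretch rho theta y ^ 2.
Proof.
  unfold unit_tangent, vunit. rewrite helicoid_boundary_speed.
  change (dvec (helicoid rho theta y) s) with (X_z (helicoid rho theta) y s).
  rewrite helicoid_z. unfold ez. unfold_vec.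
  generalize (stretch rho theta y), (stretch_ge_1 rho theta y).
  generalize (theta / rho). intros w A HA. field. lra.
Qed.

(** * The multipliers *)

Lemma tanh_opp (x : R) : tanh (- x) = - tanh x.
Proof.
  unfold tanh, sinh, cosh. rewrite Ropp_involutive, (Rplus_comm (exp (- x))).
  assert (H1 := exp_pos x). assert (H2 := exp_pos (- x)). field. lra.
Qed.

Lemma cosh_pos (x : R) : 0 < cosh x.
Proof.
  unfold cosh. assert (H1 := exp_pos x). assert (H2 := exp_pos (- x)). lra.
Qed.

Lemma tanh_sqr_le_1 (x : R) : tanh x ^ 2 <= 1.
Proof.
  assert (H : 1 - tanh x ^ 2 = (/ cosh x) ^ 2).
  { assert (Hc := cosh_pos x). unfold tanh.
    apply Rmult_eq_reg_r with (cosh x ^ 2); [|apply pow_nonzero; lra].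
    transitivity (cosh x ^ 2 - sinh x ^ 2); [field; lra|].
    transitivity 1; [|field; lra].
    unfold cosh, sinh.
    transitivity (exp x * exp (- x)); [field|].
    rewrite <- exp_plus, Rplus_opp_r. apply exp_0. }
  assert (H2 := pow2_ge_0 (/ cosh x)). lra.
Qed.

Lemma tanh_pos (x : R) : 0 < x -> 0 < tanh x.
Proof.
  intros H. apply Rdiv_lt_0_compat; [|apply cosh_pos].
  unfold sinh. assert (exp (- x) < exp x) by (apply exp_increasing; lra). lra.
Qed.

Lemma mult_tanh_nonneg (k y : R) : 0 < k -> 0 <= y * tanh (k * y).
Proof.
  intros Hk. destruct (Rtotal_order y 0) as [H | [-> | H]].
  - replace y with (- - y) by ring. rewrite <- Ropp_mult_distr_r, tanh_opp.
    assert (0 < tanh (k * - y)) by (apply tanh_pos, Rmult_lt_0_compat; lra). nra.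
  - lra.
  - assert (0 < tanh (k * y)) by (apply tanh_pos, Rmult_lt_0_compat; lra). nra.
Qed.

Lemma is_derive_tanh_scal (k y : R) :
  is_derive (fun s => tanh (k * s)) y (k * (1 - tanh (k * y) ^ 2)).
Proof.
  assert (H := cosh_pos (k * y)).
  unfold tanh, sinh, cosh in *. auto_derive; [lra|].
  field. lra.
Qed.

Lemma is_derive_stretch (rho theta y : R) :
  is_derive (stretch rho theta) y ((theta / rho) ^ 2 * y / stretch rho theta y).
Proof.
  assert (H := stretch_ge_1 rho theta y). unfold stretch in *.
  assert (H' := pow2_ge_0 (theta / rho * y)).
  generalize dependent (theta / rho). intros w H H'. auto_derive.
  - simpl in H'. lra.
  - change (w * y * (w * y * 1)) with ((w * y) ^ 2). field. lra.
Qed.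

(** For theta = 0, k tanh(k y) solves the Riccati equation W' + W^2 = k^2; it is
    rescaled by 1 / (k tanh k) < 1, which makes its value at y = 1 the boundary
    weight exactly, and by the stretch factor, which only helps because
    y tanh(k y) >= 0. *)
Definition weight_y (rho theta k y : R) : R :=
  tanh (k * y) / (tanh k * stretch rho theta y).

Definition weight_y' (rho theta k y : R) : R :=
  k * (1 - tanh (k * y) ^ 2) / (tanh k * stretch rho theta y)
  - tanh (k * y) * (theta / rho) ^ 2 * y / (tanh k * stretch rho theta y ^ 3).

(** Logarithmic derivative of cos(b (z - rho / 2)), which is positive on
    [0, rho] as long as b rho < pi. *)
Definition weight_z (rho b z : R) : R := - b * tan (b * (z - rho / 2)).

(** The derivative of [weight_z], written through the Riccati equation that it
    solves. *)
Definition weight_z' (rho b z : R) : R := - b ^ 2 - weight_z rho b z ^ 2.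

Lemma is_derive_weight_y (rho theta k y : R) : 0 < k ->
  is_derive (weight_y rho theta k) y (weight_y' rho theta k y).
Proof.
  intros Hk. assert (Ht := tanh_pos k Hk).
  assert (HA := stretch_ge_1 rho theta y).
  assert (HdA := is_derive_stretch rho theta y).
  assert (HdT := is_derive_tanh_scal k y).
  unfold weight_y, weight_y'.
  set (T := fun s => tanh (k * s)) in *. set (A := stretch rho theta) in *.
  change (tanh (k * y)) with (T y) in *.
  change (is_derive (fun s => T s / (tanh k * A s)) y
    (k * (1 - T y ^ 2) / (tanh k * A y)
     - T y * (theta / rho) ^ 2 * y / (tanh k * A y ^ 3))).
  auto_derive.
  - repeat split; [eexists; exact HdT | eexists; exact HdA |].
    apply Rmult_integral_contrapositive_currified; lra.
  - replace (Derive (fun s : R => T s) y) with (k * (1 - T y ^ 2))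
      by (symmetry; exact (is_derive_unique T y _ HdT)).
    replace (Derive (fun s : R => A s) y) with ((theta / rho) ^ 2 * y / A y)
      by (symmetry; exact (is_derive_unique A y _ HdA)).
    generalize (theta / rho). intros w. field. lra.
Qed.

Lemma continuous_weight_y' (rho theta k y : R) : 0 < k ->
  continuous (weight_y' rho theta k) y.
Proof.
  intros Hk. assert (Ht := tanh_pos k Hk).
  assert (HA := stretch_ge_1 rho theta y).
  assert (HdA := is_derive_stretch rho theta y).
  assert (HdT := is_derive_tanh_scal k y).
  apply (ex_derive_continuous (K := R_AbsRing) (V := R_NormedModule)).
  unfold weight_y'.
  set (T := fun s => tanh (k * s)) in *. set (A := stretch rho theta) in *.
  change (ex_derive (fun s => k * (1 - T s ^ 2) / (tanh k * A s)
     - T s * (theta / rho) ^ 2 * s / (tanh k * A s ^ 3)) y).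
  generalize (theta / rho). intros w.
  assert (ET : ex_derive (fun s => T s) y) by (eexists; exact HdT).
  assert (EA : ex_derive (fun s => A s) y) by (eexists; exact HdA).
  auto_derive. repeat split; auto.
  - apply Rmult_integral_contrapositive_currified; lra.
  - apply Rmult_integral_contrapositive_currified; [lra|].
    apply (pow_nonzero (A y) 3). lra.
Qed.

Lemma weight_y_boundary (rho theta k : R) : 0 < k ->
  weight_y rho theta k 1 = / stretch rho theta 1 /\
  weight_y rho theta k (-1) = - / stretch rho theta 1.
Proof.
  intros Hk. assert (Ht := tanh_pos k Hk).
  assert (HA := stretch_ge_1 rho theta 1).
  unfold weight_y. replace (-1) with (Ropp 1) by ring.
  rewrite stretch_opp, <- Ropp_mult_distr_r, tanh_opp, Rmult_1_r.
  split; field; lra.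
Qed.

Lemma is_derive_weight_z (rho b z : R) : cos (b * (z - rho / 2)) <> 0 ->
  is_derive (weight_z rho b) z (weight_z' rho b z).
Proof.
  intros H. unfold weight_z', weight_z, tan. auto_derive; auto.
  change (z + - (rho / 2)) with (z - rho / 2).
  generalize dependent (b * (z - rho / 2)). intros x H. field. auto.
Qed.

Lemma weight_z_regular (rho b z : R) : cos (b * (z - rho / 2)) <> 0 ->
  locally z (fun t => is_derive (weight_z rho b) t (weight_z' rho b t)
                      /\ continuous (weight_z' rho b) t).
Proof.
  intros H.
  assert (Hc : continuous (fun t => cos (b * (t - rho / 2))) z).
  { apply (ex_derive_continuous (K := R_AbsRing) (V := R_NormedModule)).
    auto_derive. auto. }
  generalize (Hc _ (open_neq 0 _ H)).
  unfold filtermap. apply filter_imp. intros t Ht.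
  assert (Hd := is_derive_weight_z rho b t Ht). split; auto.
  apply (ex_derive_continuous (K := R_AbsRing) (V := R_NormedModule)).
  unfold weight_z'. auto_derive. repeat split. eexists; exact Hd.
Qed.

(** With c, p, q for the function and its partial derivatives, A and T for the
    stretch and tanh(k y) at Y, t for tanh k, v for [weight_z] and W = T / (t A)
    for [weight_y], the difference of the two sides is
      A (p - W c / A)^2 + (q - v c)^2 / A
    plus c^2 / A times a sum of nonnegative terms: A >= 1 disposes of the
    curvature term, 1 < k t of the terms in T^2, and Y T >= 0 of the term coming
    from the derivative of the stretch. *)
Lemma integrand_bound (w k t T A Y v b d c p q : R) :
  1 <= A -> A ^ 2 = 1 + (w * Y) ^ 2 ->
  0 < t -> 1 < k * t -> T ^ 2 <= 1 -> 0 <= Y * T ->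
  b ^ 2 = 2 * w ^ 2 + k / t + d ->
  ((k * (1 - T ^ 2) / (t * A) - T * w ^ 2 * Y / (t * A ^ 3)) * c ^ 2
     + 2 * (T / (t * A)) * c * p)
  + (/ A * ((- b ^ 2 - v ^ 2) * c ^ 2 + 2 * v * c * q) + d * / A * c ^ 2)
  <= (p ^ 2 + q ^ 2 / A ^ 2 + 2 * (- w ^ 2 / A ^ 4) * c ^ 2) * A.
Proof.
  intros HA HA2 Ht Hkt HT HYT Hb.
  apply Rminus_le_0.
  match goal with |- 0 <= ?D => replace D with
    (A * (p - T / (t * A) / A * c) ^ 2 + (q - v * c) ^ 2 / A
     + c ^ 2 / A * (2 * w ^ 2 * (1 - / A ^ 2)
        + T ^ 2 / t * (k - / t * / A ^ 2)
        + w ^ 2 * (Y * T) / (t * A ^ 2))) end.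
  2: { rewrite Hb. field. lra. }
  assert (HAi : 0 < / A ^ 2 <= 1).
  { split.
    - apply Rinv_0_lt_compat, pow_lt; lra.
    - rewrite <- Rinv_1. apply Rinv_le_contravar; [lra|]. nra. }
  assert (Hti : 0 < / t < k).
  { split; [now apply Rinv_0_lt_compat|].
    apply Rmult_lt_reg_r with t; auto. rewrite Rinv_l; lra. }
  assert (HA0 : 0 < / A) by (apply Rinv_0_lt_compat; lra).
  apply Rplus_le_le_0_compat; [apply Rplus_le_le_0_compat|].
  - apply Rmult_le_pos; [lra | apply pow2_ge_0].
  - apply Rmult_le_pos; [apply pow2_ge_0 | lra].
  - apply Rmult_le_pos; [apply Rmult_le_pos; [apply pow2_ge_0 | lra]|].
    assert (0 <= w ^ 2) by apply pow2_ge_0.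
    apply Rplus_le_le_0_compat; [apply Rplus_le_le_0_compat|].
    + apply Rmult_le_pos; lra.
    + apply Rmult_le_pos; [|nra].
      apply Rmult_le_pos; [apply pow2_ge_0 | lra].
    + unfold Rdiv. rewrite Rinv_mult. apply Rmult_le_pos; [now apply Rmult_le_pos|].
      apply Rmult_le_pos; lra.
Qed.

(** * Positivity of the second variation *)

Lemma ex_diff_2_C1_pt (u : R -> R -> R) (y z : R) :
  ex_diff_n u 2 y z -> C1_pt u y z.
Proof.
  intros (Cu & Dy & Dz & (Cy & _) & (Cz & _)). repeat split; auto.
Qed.

(** The point (y0, z0) where u is nonzero makes the remainder d u^2 / A have
    positive integral. *)
Lemma second_variation_pos (rho theta : R) (u : R -> R -> R) (y0 z0 : R) :
  0 < rho ->
  1 < sqrt ((PI ^ 2 - 2 * theta ^ 2) / rho ^ 2)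
      * tanh (sqrt ((PI ^ 2 - 2 * theta ^ 2) / rho ^ 2)) ->
  (forall y z, in_rect rho y z -> locally_2d (C1_pt u) y z) ->
  (forall y, -1 <= y <= 1 -> u y 0 = 0 /\ u y rho = 0) ->
  in_rect rho y0 z0 -> u y0 z0 <> 0 ->
  RInt (fun z => (u 1 z ^ 2 + u (-1) z ^ 2) / stretch rho theta 1) 0 rho
  < iterated_RInt
      (fun y z => (Derive (fun s => u s z) y ^ 2
                   + Derive (fun t => u y t) z ^ 2 / stretch rho theta y ^ 2
                   + 2 * (- (theta / rho) ^ 2 / stretch rho theta y ^ 4) * u y z ^ 2)
                  * stretch rho theta y) (-1) 1 0 rho.
Proof.
  intros Hrho Hcond Hu Hwire [Hy0 Hz0] Hne.
  set (k := sqrt ((PI ^ 2 - 2 * theta ^ 2) / rho ^ 2)) in *.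
  set (w := theta / rho).
  assert (Hk : 0 < k).
  { destruct (Rle_lt_or_eq_dec 0 k (sqrt_pos _)) as [|E]; auto.
    rewrite <- E, Rmult_0_l in Hcond. lra. }
  assert (Ht := tanh_pos k Hk).
  assert (Hk2 : k ^ 2 = (PI / rho) ^ 2 - 2 * w ^ 2).
  { transitivity ((PI ^ 2 - 2 * theta ^ 2) / rho ^ 2).
    - apply pow2_sqrt. destruct (Rle_lt_dec 0 ((PI ^ 2 - 2 * theta ^ 2) / rho ^ 2)); auto.
      unfold k in Hk. rewrite sqrt_neg_0 in Hk; lra.
    - unfold w. field. lra. }
  (* The y-multiplier consumes k / tanh k out of the available k^2: half of the
     excess goes to the remainder, and half keeps b below PI / rho. *)
  set (d := (k ^ 2 - k / tanh k) / 2).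
  assert (Hd : 0 < d).
  { unfold d. replace (k ^ 2 - k / tanh k) with (k / tanh k * (k * tanh k - 1))
      by (field; lra).
    apply Rdiv_lt_0_compat; [|lra].
    apply Rmult_lt_0_compat; [now apply Rdiv_lt_0_compat | lra]. }
  assert (Hkt : 0 < k / tanh k) by now apply Rdiv_lt_0_compat.
  assert (Hw2 := pow2_ge_0 w).
  set (b := sqrt (2 * w ^ 2 + k / tanh k + d)).
  assert (Hb2 : b ^ 2 = 2 * w ^ 2 + k / tanh k + d) by (apply pow2_sqrt; lra).
  assert (Hb0 : 0 <= b) by apply sqrt_pos.
  assert (HPI := PI_RGT_0).
  assert (Hbpi : b < PI / rho).
  { apply Rsqr_incrst_0; auto.
    - rewrite !Rsqr_pow2, Hb2. unfold d in *. lra.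
    - now apply Rlt_le, Rdiv_lt_0_compat. }
  assert (Hcos : forall z, 0 <= z <= rho -> cos (b * (z - rho / 2)) <> 0).
  { intros z Hz. apply Rgt_not_eq, Rlt_gt, cos_gt_0;
      assert (b * rho < PI) by
        (apply Rmult_lt_reg_r with (/ rho); [now apply Rinv_0_lt_compat|];
         rewrite Rmult_assoc, Rinv_r, Rmult_1_r by lra; exact Hbpi); nra. }
  assert (Hv : forall z, 0 <= z <= rho ->
    locally z (fun t => is_derive (weight_z rho b) t (weight_z' rho b t)
                        /\ continuous (weight_z' rho b) t))
    by (intros; now apply weight_z_regular, Hcos).
  assert (HA := stretch_ge_1 rho theta).
  assert (CA : forall y, continuous (stretch rho theta) y)
    by (intros y; eapply is_derive_continuous, is_derive_stretch).
  assert (CAi : forall y, continuous (fun s => / stretch rho theta s) y).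
  { intros y. apply continuous_Rinv_comp; auto. specialize (HA y). lra. }
  assert (Cw' := fun y => continuous_weight_y' rho theta k y Hk).
  assert (Dw := fun y => is_derive_weight_y rho theta k y Hk).
  assert (Cw : forall y, continuous (weight_y rho theta k) y)
    by (intros y; eapply is_derive_continuous, Dw).
  assert (Hu' : near_slices (C1_pt u) (-1) 1 0 rho).
  { intros z Hz. apply locally_2d_tube. intros y Hy. apply Hu. now split. }
  assert (Huv : near_slices (fun y z => C1_pt u y z /\
      (continuous (weight_z rho b) z /\ continuous (weight_z' rho b) z)) (-1) 1 0 rho).
  { intros z Hz. generalize (filter_and _ _ (Hu' z Hz) (Hv z Hz)).
    apply filter_imp. intros t [H1 [H2 H3]] y Hy. repeat split; try apply H1; auto.
    now apply is_derive_continuous with (weight_z' rho b t). }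
  set (fy := fun y z => weight_y' rho theta k y * u y z ^ 2
               + 2 * weight_y rho theta k y * u y z * Derive (fun s => u s z) y).
  set (fz := fun y z => / stretch rho theta y * (weight_z' rho b z * u y z ^ 2
               + 2 * weight_z rho b z * u y z * Derive (fun t => u y t) z)).
  set (fr := fun y z => d * / stretch rho theta y * u y z ^ 2).
  assert (Cfy : near_slices (continuity_2d_pt fy) (-1) 1 0 rho).
  { revert Hu'. apply near_slices_imp. intros y z Hy (Cu & _ & _ & Cy & _).
    specialize (Cw y). specialize (Cw' y). unfold fy. continuity_2d. }
  assert (Cfz : near_slices (continuity_2d_pt fz) (-1) 1 0 rho).
  { revert Huv. apply near_slices_imp. intros y z Hy [(Cu & _ & _ & _ & Cz) [H1 H2]].
    specialize (CAi y). unfold fz. continuity_2d. }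
  assert (Cfr : near_slices (continuity_2d_pt fr) (-1) 1 0 rho).
  { revert Hu'. apply near_slices_imp. intros y z Hy (Cu & _).
    specialize (CAi y). unfold fr. continuity_2d. }
  assert (Cfzr : near_slices (continuity_2d_pt (fun y z => fz y z + fr y z)) (-1) 1 0 rho).
  { intros z Hz. generalize (filter_and _ _ (Cfz z Hz) (Cfr z Hz)).
    apply filter_imp. intros t [H1 H2] y Hy. apply continuity_2d_pt_plus; auto. }
  assert (Iy : iterated_RInt fy (-1) 1 0 rho
    = RInt (fun z => (u 1 z ^ 2 + u (-1) z ^ 2) / stretch rho theta 1) 0 rho).
  { apply RInt_ext. rewrite Rmin_left, Rmax_right by lra. intros z Hz.
    unfold fy. rewrite RInt_flux_y; [|lra|auto|].
    - destruct (weight_y_boundary rho theta k Hk) as [-> ->].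
      unfold Rdiv. lra.
    - intros y Hy. apply (near_slices_at _ _ _ _ _ y z Hu'); lra. }
  assert (Iz : iterated_RInt fz (-1) 1 0 rho = 0).
  { apply (iterated_RInt_flux_z (fun y => / stretch rho theta y)); auto; try lra.
    intros y z Hy Hz. now apply Hu. }
  assert (Ir : 0 < iterated_RInt fr (-1) 1 0 rho).
  { assert (Hw : forall y, 0 < d * / stretch rho theta y).
    { intros y. specialize (HA y). apply Rmult_lt_0_compat; auto.
      apply Rinv_0_lt_compat; lra. }
    apply iterated_RInt_pos with y0 z0; auto; try lra.
    - intros y z _ _. apply Rmult_le_pos; [now apply Rlt_le | apply pow2_ge_0].
    - apply Rmult_lt_0_compat; auto. now apply pow2_gt_0. }
  rewrite <- Iy.
  apply Rlt_le_trans with (iterated_RInt (fun y z => fy y z + (fz y z + fr y z)) (-1) 1 0 rho).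
  { rewrite iterated_RInt_plus, iterated_RInt_plus; auto; lra. }
  apply iterated_RInt_le; try lra.
  - intros z Hz. generalize (filter_and _ _ (Cfy z Hz) (Cfzr z Hz)).
    apply filter_imp. intros t [H1 H2] y Hy. apply continuity_2d_pt_plus; auto.
  - revert Hu'. apply near_slices_imp. intros y z Hy (Cu & _ & _ & Cy & Cz).
    specialize (CA y). specialize (HA y).
    assert (Hpow : forall n, continuity_2d_pt (fun s _ => / stretch rho theta s ^ n) y z).
    { intros n. apply (continuity_2d_pt_fst (fun s => / stretch rho theta s ^ n)).
      apply continuous_Rinv_comp; [|apply pow_nonzero; lra].
      assert (HdA := is_derive_stretch rho theta y).
      apply (ex_derive_continuous (K := R_AbsRing) (V := R_NormedModule)).
      apply ex_derive_pow. eexists; exact HdA. }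
    unfold Rdiv. continuity_2d; apply Hpow.
  - intros y z Hy Hz. apply integrand_bound; auto.
    + apply stretch_sqr.
    + apply tanh_sqr_le_1.
    + now apply mult_tanh_nonneg.
Qed.

(** * From the helicoid to the chart *)

Lemma V_N_wire_value (rho theta y z : R) (c : vec -> R) :
  0 < rho -> V_N rho theta c -> -1 <= y <= 1 -> z = 0 \/ z = rho ->
  c (helicoid rho theta y z) = 0.
Proof.
  intros Hrho [_ Hc] Hy Hz. apply Hc. exists y, z.
  repeat split; auto; destruct Hz; lra.
Qed.

(** Only the values of c on the helicoid are those of u, so its derivatives
    agree with those of u in the interior of the rectangle, up to the edges that
    the differentiation does not cross. *)
Lemma Derive_chart_y (rho theta : R) (c : vec -> R) (u : R -> R -> R) (y z : R) :
  (forall y z, in_rect rho y z -> c (helicoid rho theta y z) = u y z) ->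
  -1 < y < 1 -> 0 <= z <= rho ->
  Derive (fun s => c (helicoid rho theta s z)) y = Derive (fun s => u s z) y.
Proof.
  intros Hcu Hy Hz. apply Derive_ext_loc.
  apply (locally_interval _ y (-1) 1); simpl; try lra.
  intros s H1 H2. apply Hcu. simpl in *. split; lra.
Qed.

Lemma Derive_chart_z (rho theta : R) (c : vec -> R) (u : R -> R -> R) (y z : R) :
  (forall y z, in_rect rho y z -> c (helicoid rho theta y z) = u y z) ->
  -1 <= y <= 1 -> 0 < z < rho ->
  Derive (fun t => c (helicoid rho theta y t)) z = Derive (fun t => u y t) z.
Proof.
  intros Hcu Hy Hz. apply Derive_ext_loc.
  apply (locally_interval _ z 0 rho); simpl; try lra.
  intros s H1 H2. apply Hcu. simpl in *. split; lra.
Qed.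

(** The squared weight 1 / A(1)^2 and the length element A(1) leave one factor
    1 / A(1) on each of the two curves. *)
Lemma free_boundary_integral_chart (rho theta : R) (c : vec -> R) (u : R -> R -> R) :
  0 < rho ->
  (forall y z, in_rect rho y z -> locally_2d (C1_pt u) y z) ->
  (forall y z, in_rect rho y z -> c (helicoid rho theta y z) = u y z) ->
  free_boundary_integral rho theta
    (fun g s => vdot (unit_tangent g s) ez ^ 2 * c (g s) ^ 2)
  = RInt (fun z => (u 1 z ^ 2 + u (-1) z ^ 2) / stretch rho theta 1) 0 rho.
Proof.
  intros Hrho Hu Hcu. unfold free_boundary_integral, curve_integral.
  assert (HA := stretch_ge_1 rho theta 1).
  assert (Hside : forall y, y = 1 \/ y = -1 ->
    RInt (fun s => vdot (unit_tangent (helicoid rho theta y) s) ez ^ 2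
                   * c (helicoid rho theta y s) ^ 2
                   * vnorm (dvec (helicoid rho theta y) s)) 0 rho
    = RInt (fun z => u y z ^ 2 / stretch rho theta 1) 0 rho).
  { intros y Hy. apply RInt_ext. rewrite Rmin_left, Rmax_right by lra. intros s Hs.
    rewrite helicoid_boundary_weight, helicoid_boundary_speed, Hcu
      by (split; destruct Hy; lra).
    replace (stretch rho theta y) with (stretch rho theta 1)
      by (destruct Hy as [-> | ->]; auto; symmetry; apply (stretch_opp rho theta 1)).
    match goal with |- @eq _ ?l ?r => change (@eq R l r) end. field. lra. }
  rewrite !Hside by auto.
  assert (Hex : forall y, -1 <= y <= 1 ->
    ex_RInt (fun z => u y z ^ 2 / stretch rho theta 1) 0 rho).
  { intros y Hy. apply (ex_RInt_continuous (V := R_CompleteNormedModule)).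
    rewrite Rmin_left, Rmax_right by lra. intros z Hz.
    apply (continuity_2d_pt_slice_r (fun y z => u y z ^ 2 / stretch rho theta 1)).
    assert (Cu : continuity_2d_pt u y z)
      by (apply (locally_2d_singleton (C1_pt u)), Hu; now split).
    unfold Rdiv. continuity_2d. }
  rewrite <- (RInt_plus (V := R_CompleteNormedModule)) by (apply Hex; lra).
  apply RInt_ext. intros z _. unfold plus; simpl. unfold Rdiv. lra.
Qed.

(** The integrand is only identified inside the open rectangle, since c is
    arbitrary off the helicoid; this is enough for the integrals. *)
Lemma surface_integral_chart (rho theta : R) (c : vec -> R) (u : R -> R -> R) :
  0 < rho ->
  (forall y z, in_rect rho y z -> c (helicoid rho theta y z) = u y z) ->
  surface_integral (helicoid rho theta) (-1) 1 0 rho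
    (fun y z =>
       vdot (surface_gradient (helicoid rho theta) c y z)
            (surface_gradient (helicoid rho theta) c y z)
       + 2 * gauss_curvature (helicoid rho theta) y z
           * (c (helicoid rho theta y z)) ^ 2)
  = iterated_RInt
      (fun y z => (Derive (fun s => u s z) y ^ 2
                   + Derive (fun t => u y t) z ^ 2 / stretch rho theta y ^ 2
                   + 2 * (- (theta / rho) ^ 2 / stretch rho theta y ^ 4) * u y z ^ 2)
                  * stretch rho theta y) (-1) 1 0 rho.
Proof.
  intros Hrho Hcu. unfold surface_integral, iterated_RInt.
  apply RInt_ext. rewrite Rmin_left, Rmax_right by lra. intros z Hz.
  apply RInt_ext. rewrite Rmin_left, Rmax_right by lra. intros y Hy.
  rewrite helicoid_gradient_sqr, helicoid_curvature, helicoid_area.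
  rewrite (Derive_chart_y rho theta c u), (Derive_chart_z rho theta c u), Hcu
    by (auto; try split; lra).
  reflexivity.
Qed.

Theorem proposition5p5 (rho theta : R) (Hrho : 0 < rho) (Htheta : 0 <= theta)
    (Hreal : 0 <= PI ^ 2 - 2 * theta ^ 2)
    (Hcond : 1 < sqrt ((PI ^ 2 - 2 * theta ^ 2) / rho ^ 2)
                 * tanh (sqrt ((PI ^ 2 - 2 * theta ^ 2) / rho ^ 2))) :
  stable rho theta.
Proof.
  intros c Hc [p [[y0 [z0 [Hrect ->]]] Hne]].
  assert (Hwire := fun y z => V_N_wire_value rho theta y z c Hrho Hc).
  destruct Hc as [[u [Hu2 Hcu]] _].
  assert (Hu : forall y z, in_rect rho y z -> locally_2d (C1_pt u) y z).
  { intros y z Hyz. generalize (Hu2 y z Hyz).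
    apply locally_2d_impl, locally_2d_forall. intros s t. apply ex_diff_2_C1_pt. }
  rewrite (free_boundary_integral_chart rho theta c u) by auto.
  rewrite (surface_integral_chart rho theta c u) by auto.
  apply second_variation_pos with y0 z0; auto.
  - intros y Hy. rewrite <- !Hcu by (split; lra). auto.
  - rewrite <- Hcu; auto.
Qed.
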